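(* Let $a\ge 1$ be an integer, and let $f_0$ be defined by $f_0(1)=1$, $f_0(2)=0$, and $f_0(n+2)=af_0(n)$ for $n\ge 1$. For $1\le k\le n$ let $$c_1(n,k)=\sum_{i_1+i_2+\cdots+i_k=n}f_0(i_1)f_0(i_2)\cdots f_0(i_k),$$ the sum being over positive integers $i_1,\ldots,i_k$. Then $$c_1(n,k)=\begin{cases}a^{\frac{n-k}{2}}\binom{\frac{n+k}{2}-1}{k-1},&\text{if } n-k \text{ is even};\\ 0,&\text{if } n-k\text{ is odd}.\end{cases}$$ *)

(* Defs.v *)
From mathcomp Require Import all_boot.

Set Implicit Arguments.
Unset Strict Implicit.
Unset Printing Implicit Defensive.

(* Sum over all (i_1, ..., i_k) with every i_j >= 1 and i_1 + ... + i_k = n.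
   The codomain 'I_n.+1 loses nothing, since each part of such a tuple is <= n.
   The value f 0 never contributes. *)
Definition composition_sum (f : nat -> nat) (n k : nat) : nat :=
  \sum_(i : {ffun 'I_k -> 'I_n.+1}
         | [forall j, 1 <= i j] && (\sum_(j < k) i j == n))
     \prod_(j < k) f (i j).

(* Main.v *)
Require Import Defs.
From mathcomp Require Import all_boot.

(** Since [f0 (2 * m).+1 = a ^ m] and [f0] vanishes at the positive even
    numbers, only the compositions of [n] into odd parts contribute.  Writing
    each part as [2 * q_j + 1], the parts sum to [n] exactly when
    [2 * \sum_j q_j + k = n].  Hence there is no such composition when [n - k]
    is odd; when [n = k + 2 * m] every one of them has weight
    [\prod_j a ^ q_j = a ^ m], and they are as many as the weak compositions of
    [m] into [k] parts, which [card_ord_partitions] counts. *)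

Section GeometricSequence.

Variables (a : nat) (f : nat -> nat).
Hypotheses (f1 : f 1 = 1) (f2 : f 2 = 0).
Hypothesis frec : forall n, 1 <= n -> f (n + 2) = a * f n.

Lemma geometric_odd m : f m.*2.+1 = a ^ m.
Proof. by elim: m => // m IHm; rewrite doubleS -addn2 frec // IHm expnS. Qed.

Lemma geometric_even m : f m.*2.+2 = 0.
Proof.
by elim: m => // m IHm; rewrite doubleS -[m.*2.+4]addn2 frec // IHm muln0.
Qed.

Lemma geometric_parity i : 0 < i -> f i = if odd i then a ^ i./2 else 0.
Proof.
move=> i_gt0; case: ifPn => [odd_i | even_i].
  by rewrite -[in LHS](odd_double_half i) odd_i geometric_odd.
have := odd_double_half i; rewrite (negbTE even_i) add0n.
by case: i./2 => [|m] def_i; rewrite -def_i ?geometric_even // -def_i in i_gt0 *.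
Qed.

(** A single even part kills the product, and odd parts contribute powers of [a]
    whose exponents add up; this makes the weight depend on the composition only
    through its parities and its sum. *)
Lemma prod_geometric_parity k (i : 'I_k -> nat) : (forall j, 0 < i j) ->
  \prod_(j < k) f (i j) =
    if [forall j, odd (i j)] then a ^ (\sum_(j < k) (i j)./2) else 0.
Proof.
move=> i_gt0; case: ifPn => [/forallP odd_i | /forallPn[j even_i]].
  rewrite expn_sum; apply: eq_bigr => j _.
  by rewrite geometric_parity ?odd_i.
by rewrite (bigD1 j) //= geometric_parity // (negbTE even_i) mul0n.
Qed.

End GeometricSequence.

Lemma sum_odd_parts k (i : 'I_k -> nat) : (forall j, odd (i j)) ->
  \sum_(j < k) i j = k + (\sum_(j < k) (i j)./2).*2.
Proof.
move=> odd_i.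
have -> : k + (\sum_(j < k) (i j)./2).*2 = \sum_(j < k) (1 + ((i j)./2).*2).
  rewrite big_split /= sum1_card card_ord -mul2n big_distrr /=.
  by congr (_ + _); apply: eq_bigr => j _; rewrite mul2n.
by apply: eq_bigr => j _; rewrite -[LHS]odd_double_half odd_i.
Qed.

Lemma eq_sum_odd_parts k m (i : 'I_k -> nat) : (forall j, odd (i j)) ->
  (\sum_(j < k) i j == k + m.*2) = (\sum_(j < k) (i j)./2 == m).
Proof.
by move=> odd_i; rewrite sum_odd_parts // eqn_add2l -!muln2 eqn_pmul2r.
Qed.

(** Halving each part, [2 * q + 1 |-> q], is a bijection onto the weak
    compositions of [m] into [k.+1] parts; these are in turn counted by
    stars and bars. *)
Lemma card_odd_compositions k m :
  #|[set i : {ffun 'I_k.+1 -> 'I_(k.+1 + m.*2).+1}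
      | [forall j, odd (i j)] && (\sum_(j < k.+1) i j == k.+1 + m.*2)]|
  = 'C(k + m, k).
Proof.
rewrite -card_ord_partitions -!sum1dep_card.
pose h (t : k.+1.-tuple 'I_m.+1) : {ffun 'I_k.+1 -> 'I_(k.+1 + m.*2).+1} :=
  [ffun j => inord (tnth t j).*2.+1].
pose h' (i : {ffun 'I_k.+1 -> 'I_(k.+1 + m.*2).+1}) : k.+1.-tuple 'I_m.+1 :=
  [tuple inord (i j)./2 | j < k.+1].
(* [inord] is faithful here: [q <= m] gives [2 * q + 1 <= k + 1 + 2 * m]. *)
have hE t j : h t j = (tnth t j).*2.+1 :> nat.
  rewrite ffunE inordK // ltnS addSn ltnS.
  by apply: leq_trans (leq_addl _ _); rewrite leq_double -ltnS.
rewrite (reindex_onto h h') => [|i /andP[/forallP odd_i sum_i]].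
  apply: eq_bigl => t.
  have -> : h' (h t) = t.
    apply: eq_from_tnth => j; rewrite tnth_mktuple; apply: val_inj => /=.
    by rewrite hE /= uphalf_double inordK.
  have odd_h j : odd (h t j) by rewrite hE /= odd_double.
  rewrite eqxx andbT eq_sum_odd_parts // (introT forallP odd_h) big_tuple.
  congr (_ == _).
  by apply: eq_bigr => j _; rewrite hE /= uphalf_double.
apply/ffunP => j; apply: val_inj; rewrite /= hE tnth_mktuple inordK.
  by rewrite -[RHS]odd_double_half odd_i.
(* Conversely [q_j <= m], being one of the terms of a sum equal to [m]. *)
move: sum_i; rewrite eq_sum_odd_parts // => /eqP sum_q.
by rewrite ltnS -[leqRHS]sum_q (bigD1 j) //= leq_addr.
Qed.

Theorem proposition8 (a : nat) (ha : 1 <= a)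
    (f0 : nat -> nat)
    (hf1 : f0 1 = 1)
    (hf2 : f0 2 = 0)
    (hf : forall n : nat, 1 <= n -> f0 (n + 2) = a * f0 n)
    (n k : nat) (hk : 1 <= k) (hkn : k <= n) :
  composition_sum f0 n k =
    if ~~ odd (n - k) then a ^ ((n - k) %/ 2) * 'C((n + k) %/ 2 - 1, k - 1)
    else 0.
Proof.
have weight (i : {ffun 'I_k -> 'I_n.+1}) :
    [forall j, 1 <= i j] && (\sum_(j < k) i j == n) ->
  \prod_(j < k) f0 (i j) =
    if [forall j, odd (i j)] then a ^ (\sum_(j < k) (i j)./2) else 0.
- by case/andP=> /forallP i_gt0 _; apply: prod_geometric_parity.
rewrite /composition_sum (eq_bigr _ weight) -big_mkcondr /=.
case: ifPn => [even_nk | odd_nk]; last first.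
  rewrite big_pred0 // => i; apply/negP => /andP[/andP[_ /eqP sum_i]].
  move/forallP => odd_i; case/negP: odd_nk.
  by rewrite -sum_i sum_odd_parts // addKn odd_double.
(* From here on [n = k + 2 * m], and every surviving term equals [a ^ m]. *)
have def_n : n = k + ((n - k)./2).*2 by rewrite even_halfK // subnKC.
rewrite divn2; move: (n - k)./2 def_n {weight even_nk hkn} => m ->.
case: k hk => // k _.
rewrite divn2 addnAC addnn -doubleD half_double !subn1 addSn /=.
rewrite -card_odd_compositions mulnC -sum_nat_const.
apply: eq_big => [i | i /andP[/andP[_ sum_i] /forallP odd_i]].
  rewrite inE andbAC; congr (_ && _); apply: andb_idl => /forallP odd_i.
  by apply/forallP => j; apply: odd_gt0.
by congr (a ^ _); apply/eqP; rewrite -eq_sum_odd_parts.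
Qed.
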